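(* The number $N$ of all distinct fuzzy subgroups with respect to $\approx$ of the dihedral group $D_8=\langle a,b\mid a^4=b^2=1,\ bab=a^{-1}\rangle$ of order $8$ (that is, the number of equivalence classes of $FL(D_8)$ modulo $\approx$) is $$N=\frac18\,(32+4\cdot 8+16+2\cdot 24)=16.$$
   Context: Let $G$ be a finite group. A fuzzy subgroup of $G$ is a function $\mu:G\to[0,1]$ with $\mu(xy)\ge\min\{\mu(x),\mu(y)\}$ and $\mu(x^{-1})\ge\mu(x)$ for all $x,y\in G$; $FL(G)$ denotes the set of all fuzzy subgroups of $G$. For $\alpha\in[0,1]$ put ${}_\mu G_\alpha=\{x\in G\mid \mu(x)\ge\alpha\}$. If $\mu(G)=\{\alpha_1,\dots,\alpha_r\}$ with $\alpha_1>\alpha_2>\dots>\alpha_r$, then $\mu$ determines the chain of subgroups $\mathcal{C}_\mu:\ {}_\mu G_{\alpha_1}\subset{}_\mu G_{\alpha_2}\subset\dots\subset{}_\mu G_{\alpha_r}=G$ (strict inclusions). The relation $\approx$ on $FL(G)$: $\mu\approx\eta$ iff there exists $f\in\mathrm{Aut}(G)$ with $f(\mathcal{C}_\eta)=\mathcal{C}_\mu$, i.e. the two chains have the same number of terms and $f$ maps the $i$-th term of $\mathcal{C}_\eta$ onto the $i$-th term of $\mathcal{C}_\mu$ for every $i$. The number of distinct fuzzy subgroups of $G$ with respect to $\approx$ is the number of $\approx$-classes of $FL(G)$; equivalently, it is the number of orbits of $\mathrm{Aut}(G)$ acting termwise on the set of strictly increasing chains $H_1\subset H_2\subset\dots\subset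 H_m=G$ ($m\ge1$) of subgroups of $G$ ending in $G$ (the first term $H_1$ need not be trivial). *)

(* Defs.v *)
From mathcomp Require Import all_boot all_order all_algebra all_fingroup.
From mathcomp Require Import all_solvable.
From mathcomp Require Import boolp classical_sets functions cardinality reals.
Set Implicit Arguments.
Unset Strict Implicit.
Unset Printing Implicit Defensive.
Import Order.TTheory GRing.Theory Num.Theory.
Local Open Scope ring_scope.

(* Throughout, the group G is the whole finite group type gT. *)

Definition is_fuzzy_subgroup (R : realType) (gT : finGroupType)
    (mu : gT -> R) : Prop :=
  [/\ forall x, 0 <= mu x <= 1,
      forall x y, Num.min (mu x) (mu y) <= mu (x * y)%g
    & forall x, mu x <= mu (x^-1)%g].

Definition FL (R : realType) (gT : finGroupType) : set (gT -> R) :=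
  [set mu | is_fuzzy_subgroup mu]%classic.
Arguments FL : clear implicits.

Definition level_set (R : realType) (gT : finGroupType)
    (mu : gT -> R) (alpha : R) : {set gT} :=
  [set x | alpha <= mu x]%SET.

(* alpha_1 > alpha_2 > ... > alpha_r *)
Definition level_values (R : realType) (gT : finGroupType)
    (mu : gT -> R) : seq R :=
  sort >=%O (undup (codom mu)).

Definition level_chain (R : realType) (gT : finGroupType)
    (mu : gT -> R) : seq {set gT} :=
  [seq level_set mu alpha | alpha <- level_values mu].

(* Equality of sequences says both that the chains have the same number of
   terms and that f maps the i-th term onto the i-th term. *)
Definition fuzzy_approx (R : realType) (gT : finGroupType)
    (mu eta : gT -> R) : Prop :=
  exists2 f : {perm gT}, f \in Aut [set: gT]
    & [seq f @: (H : {set gT}) | H <- level_chain eta] = level_chain mu.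

Definition fuzzy_class (R : realType) (gT : finGroupType)
    (mu : gT -> R) : set (gT -> R) :=
  [set eta | FL R gT eta /\ fuzzy_approx mu eta]%classic.

Definition fuzzy_classes (R : realType) (gT : finGroupType) :
    set (set (gT -> R)) :=
  [set fuzzy_class mu | mu in FL R gT]%classic.
Arguments fuzzy_classes : clear implicits.

(* Main.v *)
Require Import Defs.
From mathcomp Require Import all_boot all_order all_algebra all_fingroup.
From mathcomp Require Import all_solvable.
From mathcomp Require Import boolp classical_sets functions cardinality reals.
From mathcomp Require Import zify.
Set Implicit Arguments.
Unset Strict Implicit.
Unset Printing Implicit Defensive.
Import Order.TTheory GRing.Theory Num.Theory.
Local Open Scope ring_scope.

(* Let A = <a> be the group of rotations. Sending a subgroup H to the pair
   (H <= A, |H|) gives an Aut(D_8)-invariant code with six values. For a chain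
   of subgroups, pick a reflection r in the first term not contained in A: some
   automorphism maps r to b, so every term becomes a subgroup of A or a subgroup
   containing b, and such subgroups are determined by their codes. Hence two
   fuzzy subgroups are equivalent iff their level chains have the same code
   sequences. The possible sequences are the strictly increasing ones, for
   H < K implying |H| < |K| and (K <= A -> H <= A), that end in the code of D_8;
   there are 16 of them. *)

(** * Structure of the dihedral group of order 8 *)

Definition dihedral8_gens (gT : finGroupType) (a b : gT) : Prop :=
  [/\ #|[set: gT]| = 8%N, #[a]%g = 4%N, b \notin <[a]>%g,
      forall t, t \notin <[a]>%g -> #[t]%g = 2%N
    & forall z t, z \in <[a]>%g -> t \notin <[a]>%g -> (z ^ t = z^-1)%g].

(** Finite groups with the same presentation are homomorphic images of each other, hence isomorphic;
    the facts then come from the known structure of ['D_(2 ^ 3)]. *)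
Lemma dihedral8_gensP (gT : finGroupType) :
  ([set: gT] \isog Grp (a : b : a ^+ 4, b ^+ 2, b * a * b = a^-1))%g ->
  exists a b : gT, dihedral8_gens a b.
Proof.
move=> D8.
have D8' : ([set: 'D_(2 ^ 3)%N] \isog
            Grp (a : b : a ^+ 4, b ^+ 2, b * a * b = a^-1))%g.
  move=> rT H; rewrite (Grp_2dihedral (n := 3)) //=.
  apply/existsP/existsP=> -[[x y]] /= /eqP[defH x4 y2 rel]; exists (x, y) => /=;
  (* As [y] is its own inverse, [y * x * y] is the conjugate [x ^ y], which turns one presentation
     into the other. *)
  have yV : (y^-1 = y)%g by apply/eqP; rewrite eq_invg_mul -(expgS y 1) y2.
  - by rewrite defH x4 y2 -[X in (X * x * y)%g]yV -mulgA -/(x ^ y)%g rel.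
  - by rewrite defH x4 y2 conjgE yV mulgA rel.
have isoD : [set: gT]%G \isog [set: 'D_(2 ^ 3)%N]%G.
  by rewrite isogEhom D8 D8' (isoGrp_hom D8) (isoGrp_hom D8').
have [[a b] gab _] := generators_2dihedral (isT : (1 < 3)%N) isoD.
have [oG _ oa /setDP[_ nab]] := gab.
have [[_ o2 inv] _ _ _ _] := dihedral2_structure (isT : (1 < 3)%N) gab isoD.
exists a, b; split=> // [t nt|z t Az nt]; first by apply: o2; rewrite !inE nt.
by apply: inv => //; rewrite !inE nt.
Qed.

(** * Automorphisms of the whole group *)

Section Automorphisms.
Local Open Scope group_scope.

Lemma setT_autM (gT : finGroupType) (f : {perm gT}) :
  f \in Aut [set: gT] -> {morph f : x y / x * y}.
Proof. by move=> /Aut_morphic/morphicP fM x y; rewrite fM ?inE. Qed.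

Lemma setT_autP (gT : finGroupType) (f : {perm gT}) :
  {morph f : x y / x * y} -> f \in Aut [set: gT].
Proof.
move=> fM; rewrite inE; apply/andP; split; last by apply/morphicP=> x y _ _.
by apply/fintype.subsetP=> x; rewrite !inE.
Qed.

Lemma group_set_aut (gT : finGroupType) (f : {perm gT}) (H : {set gT}) :
  f \in Aut [set: gT] -> group_set H -> group_set (f @: H).
Proof.
move=> /setT_autM fM /group_setP[H1 HM]; apply/group_setP; split.
  apply/imsetP; exists 1 => //.
  by apply: (mulgI (f 1)); rewrite mulg1 -fM mulg1.
move=> _ _ /imsetP[x Hx ->] /imsetP[y Hy ->].
by rewrite -fM imset_f // HM.
Qed.

Lemma order_aut (gT : finGroupType) (f : {perm gT}) (x : gT) :
  f \in Aut [set: gT] -> #[f x] = #[x].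
Proof.
move=> Af; rewrite -(autmE Af) order_injm ?inE //; exact: injm_autm.
Qed.

End Automorphisms.

(** * Rotations, reflections and normalization of chains *)

Section Dihedral.
Local Open Scope group_scope.

(** The rotations have index 2: by counting, every coset [<[a]> :* u] with [u] a reflection is the
    whole complement. *)
Lemma d8_mulN (gT : finGroupType) (a b : gT) : dihedral8_gens a b ->
  forall x y, x \notin <[a]> -> y \notin <[a]> -> x * y \in <[a]>.
Proof.
case=> oG oa nb _ _ x y nx ny.
have two u : u \notin <[a]> -> ~: <[a]> = <[a]> :* u.
  move=> nu; apply/esym/eqP; rewrite eqEcard; apply/andP; split.
    apply/fintype.subsetP=> _ /rcosetP[v Av ->]; rewrite !inE.
    by rewrite groupMl.
  rewrite card_rcoset -orderE oa -(leq_add2l #|<[a]>|) cardsC -cardsT oG.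
  by rewrite -orderE oa.
have : x \in <[a]> :* y^-1 by rewrite -two ?inE ?groupV.
by case/rcosetP=> v Av ->; rewrite mulgKV.
Qed.

(** The image of [a] has order 4, while every element outside [<[a]>] has order 2. *)
Lemma d8_autA (gT : finGroupType) (a b : gT) : dihedral8_gens a b ->
  forall f : {perm gT}, f \in Aut [set: gT] -> f @: <[a]> = <[a]>.
Proof.
case=> oG oa nb o2 _ f Af; apply/eqP.
rewrite eqEcard card_imset ?leqnn ?andbT; last exact: perm_inj.
apply/fintype.subsetP=> _ /imsetP[_ /cycleP[i ->] ->].
rewrite -(autmE Af) morphX ?inE //= autmE groupX //.
apply/negPn/negP=> /o2.
by rewrite order_aut // oa.
Qed.

(* Outside the rotations A, the automorphism is left translation by the
   rotation c = b r^-1; it is multiplicative because A is abelian and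
   inverted by every reflection. *)
Lemma d8_aut_reflection (gT : finGroupType) (a b : gT) : dihedral8_gens a b ->
  forall r, r \notin <[a]> ->
  exists2 f : {perm gT}, f \in Aut [set: gT] & f r = b.
Proof.
move=> D r nr; have [oG oa nb o2 inv] := D.
have [c Ac cr] : exists2 c, c \in <[a]> & c * r = b.
  by exists (b * r^-1); rewrite ?mulgKV // (d8_mulN D) ?groupV.
pose g x := if x \in <[a]> then x else c * x.
have gA x : (g x \in <[a]>) = (x \in <[a]>).
  by rewrite /g; case: ifP => // nx; rewrite groupMl.
have g_inj : injective g.
  move=> x y gxy; have := gA x; have := gA y; rewrite gxy => -> => Exy.
  by move: gxy; rewrite /g Exy; case: ifP => // _ /mulgI.
have abA x y : x \in <[a]> -> y \in <[a]> -> x * y = y * x.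
  by move=> Ax Ay; apply: (centsP (cycle_abelian a)).
exists (perm g_inj); last by rewrite permE /g (negbTE nr).
apply: setT_autP => x y; rewrite !permE /g.
case Ax: (x \in <[a]>); case Ay: (y \in <[a]>).
- by rewrite groupM.
- by rewrite groupMl // Ay !mulgA (abA x c).
- by rewrite groupMr // Ax !mulgA.
rewrite (d8_mulN D) ?Ax ?Ay //.
by rewrite -mulgA (mulgA x c) (conjgCV x c) inv ?groupV ?Ax // !mulgA mulgV mul1g.
Qed.

Lemma d8_normalized_chain (gT : finGroupType) (a b : gT) : dihedral8_gens a b ->
  forall s : seq {set gT}, sorted (fun H K : {set gT} => H \subset K) s ->
  exists2 f : {perm gT}, f \in Aut [set: gT]
    & forall H, H \in s -> (f @: H \subset <[a]>) || (b \in f @: H).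
Proof.
move=> D s ss.
have [hs|/hasPn hs] := boolP (has (fun H : {set gT} => ~~ (H \subset <[a]>)) s).
  set P := fun H : {set gT} => _ in hs.
  have /fintype.subsetPn[r Hr nr] := nth_find finset.set0 hs.
  have [f Af fr] := d8_aut_reflection D nr.
  (* Terms before the index [find P s] consist of rotations, a property [f] preserves; the later
     ones contain [r], so their images contain [b]. *)
  exists f => // H Hs; have [lt|ge] := ltnP (index H s) (find P s).
    have := before_find finset.set0 lt; rewrite nth_index // => /negbFE HA.
    by apply/orP; left; rewrite -(d8_autA D Af) imsetS.
  apply/orP; right; rewrite -fr imset_f //.
  have tr : transitive (fun H K : {set gT} => H \subset K).
    by move=> ? ? ?; exact: fintype.subset_trans.
  have refl : reflexive (fun H K : {set gT} => H \subset K).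
    by move=> K; apply: subxx.
  have sub := sorted_leq_nth tr refl finset.set0 ss.
  have := sub (find P s) (index H s).
  rewrite !inE -has_find index_mem => /(_ hs Hs ge) /fintype.subsetP.
  by rewrite nth_index //; apply.
exists 1; first exact: group1.
move=> H /hs; rewrite negbK => HA; apply/orP; left.
by rewrite (eq_imset (g := id)) ?imset_id // => x; rewrite perm1.
Qed.
End Dihedral.

(* The Aut(D_8)-orbit of a subgroup H is determined by whether H consists of
   rotations and by the order of H. *)
Definition d8_code (gT : finGroupType) (a : gT) (H : {set gT}) : bool * nat :=
  (H \subset <[a]>%g, #|H|).

(** In order: the trivial group, the center, the rotations, the groups generated by one reflection,
    the two Klein four-groups, the whole group. *)
Definition d8_codes : seq (bool * nat) :=
  [:: (true, 1); (true, 2); (true, 4); (false, 2); (false, 4); (false, 8)]%N.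

Definition code_lt (p q : bool * nat) : bool := (p.2 < q.2)%N && (q.1 ==> p.1).

(** * Codes of subgroups and their representatives *)

Section Codes.
Local Open Scope group_scope.

Lemma d8_code_aut (gT : finGroupType) (a b : gT) : dihedral8_gens a b ->
  forall (f : {perm gT}) (H : {set gT}), f \in Aut [set: gT] ->
  d8_code a (f @: H) = d8_code a H.
Proof.
move=> D f H Af; rewrite /d8_code card_imset; last exact: perm_inj.
congr (_, _); rewrite -{1}(d8_autA D Af).
apply/idP/idP=> [/fintype.subsetP sHA|]; last exact: imsetS.
apply/fintype.subsetP=> x Hx.
by have /imsetP[y Ay /perm_inj->] := sHA _ (imset_f f Hx).
Qed.

(** A subgroup of the cyclic group [<[a]>] is determined by its order. One containing [b] is the
    product of its rotation part with [<[b]>], so its order fixes the order of the rotation part,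
    hence that part itself. *)
Lemma d8_code_inj (gT : finGroupType) (a b : gT) : dihedral8_gens a b ->
  forall H K : {group gT},
  (H \subset <[a]>) || (b \in H) -> (K \subset <[a]>) || (b \in K) ->
  d8_code a H = d8_code a K -> H :=: K.
Proof.
move=> D H K cH cK [EHK oHK]; have [_ _ nb _ _] := D.
have [sHA|nHA] := boolP (H \subset <[a]>).
  apply/eqP; rewrite (eq_subG_cyclic (cycle_cyclic a)) ?oHK //.
  by rewrite -EHK.
move: cH cK; rewrite -EHK (negbTE nHA) /= => bH bK.
(* By the modular law it suffices that [L] lies in [<[a]> * <[b]>], which holds because [x * b^-1]
   is a rotation for every reflection [x]. *)
have split_b (L : {group gT}) : b \in L -> L :=: (L :&: <[a]>) * <[b]>.
  move=> bL; rewrite group_modr ?cycle_subG //; apply/esym/finset.setIidPl.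
  apply/fintype.subsetP=> x Lx; have [Ax|nx] := boolP (x \in <[a]>).
    by rewrite -(mulg1 x) mem_mulg.
  rewrite -(mulgKV b x) mem_mulg ?cycle_id //.
  by rewrite (d8_mulN D) ?groupV.
have TI (L : {group gT}) : L :&: <[a]> :&: <[b]> = 1.
  rewrite finset.setIC prime_TIg //.
    by case: D => _ _ _ o2 _; rewrite -orderE o2.
  by rewrite cycle_subG inE negb_and nb orbT.
have cardI (L : {group gT}) : b \in L -> (#|L| = #|L :&: <[a]>| * #|<[b]>|)%N.
  by move=> bL; rewrite {1}(split_b L bL) (TI_cardMg (TI L)).
rewrite (split_b H bH) (split_b K bK); congr (_ * _).
apply/eqP; rewrite (eq_subG_cyclic (cycle_cyclic a)) ?finset.subsetIr //.
move/eqP: oHK; rewrite (cardI H bH) (cardI K bK) eqn_pmul2r //.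
Qed.

Lemma d8_code_lt (gT : finGroupType) (a : gT) (H K : {set gT}) :
  H \proper K -> code_lt (d8_code a H) (d8_code a K).
Proof.
move=> pHK; rewrite /code_lt /= proper_card //=.
by apply/implyP; apply: fintype.subset_trans; apply: proper_sub.
Qed.

Lemma d8_code_mem (gT : finGroupType) (a b : gT) : dihedral8_gens a b ->
  forall H : {group gT}, d8_code a H \in d8_codes.
Proof.
case=> oG oa _ _ _ H; rewrite /d8_code.
have : (#|H| %| 8)%N by rewrite -oG cardSg ?finset.subsetT.
have [sHA _|nHA] := boolP (H \subset <[a]>).
  have : (#|H| %| 4)%N by rewrite -oa cardSg.
  by case: #|H| => [|[|[|[|[|[]]]]]].
(* This excludes the code [(false, 1)]: the trivial group consists of rotations. *)
have : #|H| != 1%N.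
  by apply: contra nHA => /eqP/card1_trivg->; exact: sub1G.
by case: #|H| => [|[|[|[|[|[|[|[|[|[]]]]]]]]]].
Qed.

Lemma d8_codeT (gT : finGroupType) (a b : gT) : dihedral8_gens a b ->
  d8_code a [set: gT] = (false, 8%N).
Proof.
case=> oG oa nb _ _; rewrite /d8_code oG; congr (_, _); apply/negbTE.
by apply/fintype.subsetPn; exists b.
Qed.

(** A power [a ^+ (4 %/ k)] with [k] dividing 4 has order [k]; when [b] is adjoined, the rotation
    part has half the order of the group. Only the values on [d8_codes] matter. *)
Definition d8_sub (gT : finGroupType) (a b : gT) (p : bool * nat) : {group gT} :=
  (<[a ^+ (4 %/ (if p.1 then p.2 else p.2./2))%N]> <*> (if p.1 then 1 else <[b]>))%G.

Lemma d8_subK (gT : finGroupType) (a b : gT) : dihedral8_gens a b ->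
  {in d8_codes, forall p, d8_code a (d8_sub a b p) = p}.
Proof.
move=> D; have [_ oa nb o2 inv] := D.
have sub k : <[a ^+ k]> \subset <[a]> by rewrite cycle_subG mem_cycle.
have cardB k : #|<[a ^+ k]> <*> <[b]>| = (#[a ^+ k] * 2)%N.
  rewrite norm_joinEr; last by rewrite norms_cycle inv ?groupV ?mem_cycle ?cycle_id.
  have TI : <[a ^+ k]> :&: <[b]> = 1.
    rewrite finset.setIC prime_TIg //; first by rewrite -orderE o2.
    by apply: contra nb => sub_b; rewrite -cycle_subG; exact: fintype.subset_trans sub_b (sub k).
  by rewrite (TI_cardMg TI) -!orderE (o2 b).
have code1 k : d8_code a (<[a ^+ k]> <*> 1) = (true, #[a ^+ k]).
  by rewrite /d8_code joingG1 sub.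
have codeb k : d8_code a (<[a ^+ k]> <*> <[b]>) = (false, #[a ^+ k] * 2)%N.
  rewrite /d8_code cardB; congr (_, _); apply/negbTE.
  by rewrite join_subG negb_and !cycle_subG nb orbT.
move=> p; rewrite !inE.
by do 5?[case/orP]; move/eqP->; rewrite /= ?code1 ?codeb orderXgcd oa.
Qed.

(** This makes [code_lt] exact on the representatives, so every increasing code sequence comes from
    a chain of subgroups. *)
Lemma d8_sub_proper (gT : finGroupType) (a b : gT) : dihedral8_gens a b ->
  {in d8_codes &, forall p q, code_lt p q -> d8_sub a b p \proper d8_sub a b q}.
Proof.
move=> D p q cp cq ltpq; rewrite properEcard; apply/andP; split; last first.
  move: ltpq; rewrite -{1}(d8_subK D cp) -{1}(d8_subK D cq).
  by case/andP.
(* Checked on all 36 pairs: the exponent for [q] divides the one for [p], so the rotation part of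
   [p] lies in that of [q]. *)
have dv : all (fun p => all (fun q => code_lt p q ==>
    ((4 %/ (if q.1 then q.2 else q.2./2) %| 4 %/ (if p.1 then p.2 else p.2./2))%N))
    d8_codes) d8_codes by [].
have /dvdnP[k Ek] := implyP (allP (allP dv p cp) q cq) ltpq.
rewrite /d8_sub /= genS // finset.setUSS //.
  by rewrite Ek mulnC expgM cycle_subG mem_cycle.
case/andP: ltpq => _; case: (p.1); case: (q.1) => //= _; exact: sub1G.
Qed.

End Codes.

(** * Enumeration of the code sequences by computation *)

Fixpoint rel_paths (T : Type) (e : rel T) (V : seq T) (n : nat) (x : T) :
    seq (seq T) :=
  if n is n'.+1 then
    [::] :: flatten [seq [seq y :: s | s <- rel_paths e V n' y]
                    | y <- [seq y <- V | e x y]]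
  else [:: [::]].

Lemma mem_rel_paths (T : eqType) (e : rel T) (V : seq T) n x s :
  (s \in rel_paths e V n x) = [&& (size s <= n)%N, all (mem V) s & path e x s].
Proof.
elim: n x s => [|n IHn] x [|y s] //=; rewrite inE /=.
apply/flatten_mapP/idP => [[z]|/and3P[ns /andP[Vy Vs] /andP[exy ps]]].
  rewrite mem_filter => /andP[exz Vz] /mapP[t]; rewrite IHn.
  by case/and3P=> nt Vt pt [-> ->]; rewrite ltnS nt Vz Vt exz pt.
exists y; first by rewrite mem_filter exy.
by apply: map_f; rewrite IHn -ltnS ns Vs ps.
Qed.

(** Each step raises the second component by at least one. *)
Lemma code_lt_path_size p s :
  path code_lt p s -> (p.2 + size s <= (last p s).2)%N.
Proof.
elim: s p => [|q s IHs] p /=; first by rewrite addn0.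
case/andP=> /andP[lt _] /IHs; apply: leq_trans.
by rewrite addnS -addSn leq_add2r.
Qed.

(* The virtual start (true, 0) lies below every code. *)
Definition d8_code_chains : seq (seq (bool * nat)) :=
  [seq s <- rel_paths code_lt d8_codes 8 (true, 0)%N
  | last (true, 0)%N s == (false, 8)%N].

Lemma mem_d8_code_chains s : (s \in d8_code_chains) =
  [&& all (mem d8_codes) s, path code_lt (true, 0)%N s
    & last (true, 0)%N s == (false, 8)%N].
Proof.
rewrite mem_filter mem_rel_paths andbC -!andbA.
apply/and4P/and3P=> [[] //|[Vs ps ls]]; split=> //.
(* A path from [(true, 0)] to [(false, 8)] has at most 8 entries, so the length bound 8 loses
   none. *)
by have := code_lt_path_size ps; rewrite (eqP ls).
Qed.

Lemma size_d8_code_chains : size d8_code_chains = 16%N.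
Proof. by vm_compute. Qed.

Lemma uniq_d8_code_chains : uniq d8_code_chains.
Proof. by vm_compute. Qed.

(** * Level chains of fuzzy subgroups and their realization *)

Section FuzzyChains.

Lemma fuzzy_le1 (R : realType) (gT : finGroupType) (mu : gT -> R) :
  is_fuzzy_subgroup mu -> forall x, mu x <= mu 1%g.
Proof.
case=> _ muM muV x; rewrite -(mulgV x).
by apply: le_trans (muM _ _); rewrite le_min lexx muV.
Qed.

Lemma mem_level_values (R : realType) (gT : finGroupType) (mu : gT -> R) v :
  (v \in level_values mu) = (v \in codom mu).
Proof. by rewrite mem_sort mem_undup. Qed.

Lemma level_values_sorted (R : realType) (gT : finGroupType) (mu : gT -> R) :
  sorted >%O (level_values mu).
Proof.
have u : uniq (level_values mu) by rewrite sort_uniq undup_uniq.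
have s : sorted >=%O (level_values mu).
  by apply: sort_sorted => x y; apply: ge_total.
by rewrite -[level_values mu]revK rev_sorted lt_sorted_uniq_le rev_uniq u rev_sorted.
Qed.

Lemma level_chain_group (R : realType) (gT : finGroupType) (mu : gT -> R) :
  is_fuzzy_subgroup mu -> {in level_chain mu, forall H, group_set H}.
Proof.
move=> fmu _ /mapP[v + ->]; rewrite mem_level_values => /codomP[x ->].
have [_ muM _] := fmu; apply/group_setP; split=> [|y z].
  by rewrite inE fuzzy_le1.
by rewrite !inE => xy xz; apply: le_trans (muM y z); rewrite le_min xy.
Qed.

Lemma level_chain_proper (R : realType) (gT : finGroupType) (mu : gT -> R) :
  sorted (fun H K : {set gT} => H \proper K) (level_chain mu).
Proof.
apply: (homo_sorted_in (P := mem (level_values mu))) (level_values_sorted mu).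
  move=> u v _ vs; have : v \in level_values mu by [].
  rewrite mem_level_values => /codomP[x ->] ux.
  (* The point [x] attains the lower value, so it is new in the larger level set. *)
  apply/properP; split.
    by apply/fintype.subsetP=> y; rewrite !inE => /(le_trans (ltW ux)).
  by exists x; rewrite !inE // -ltNge.
by apply/allP.
Qed.

(** The last value is the least one. Since the default [set0] is not the full group, the equation
    also forces the chain to be nonempty. *)
Lemma level_chain_last (R : realType) (gT : finGroupType) (mu : gT -> R) :
  last finset.set0 (level_chain mu) = [set: gT]%SET.
Proof.
have := level_values_sorted mu; have := mem_level_values mu.
rewrite /level_chain; case/lastP: (level_values mu) => [|s v] mem_s.
  by have := mem_s (mu 1%g); rewrite in_nil codom_f.
rewrite map_rcons last_rcons sorted_pairwise; last exact: rev_trans lt_trans.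
rewrite pairwise_rcons => /andP[/allP lt_s _].
apply/setP=> x; rewrite !inE.
have : mu x \in rcons s v by rewrite mem_s codom_f.
rewrite mem_rcons inE => /predU1P[->|/lt_s] /=; first exact: lexx.
exact: ltW.
Qed.

(* The i-th of m terms is cut out at height (m - i) / m. *)
Lemma chain_realization (R : realType) (gT : finGroupType) (s : seq {set gT}) :
  {in s, forall H, group_set H} ->
  sorted (fun H K : {set gT} => H \proper K) s ->
  last finset.set0 s = [set: gT]%SET ->
  exists2 mu : gT -> R, is_fuzzy_subgroup mu & level_chain mu = s.
Proof.
move=> gs ps ls; pose m := size s.
pose idx x := find (fun H : {set gT} => x \in H) s.
have Ts : [set: gT]%SET \in s.
  rewrite -ls; case: (s) ls => [|H t _] /=; last exact: mem_last.
  by move/setP/(_ 1%g); rewrite !inE.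
have idx_lt x : (idx x < m)%N.
  by rewrite -has_find; apply/hasP; exists [set: gT]%SET.
have m_gt0 : (0 < m)%N := leq_ltn_trans (leq0n _) (idx_lt 1%g).
have tr : transitive (fun H K : {set gT} => H \proper K).
  by move=> H K L; apply: proper_trans.
have mem_nths i x : (i < m)%N -> (x \in nth finset.set0 s i) = (idx x <= i)%N.
  move=> im; apply/idP/idP => [xi|].
    by rewrite leqNgt; apply/negP=> /(before_find finset.set0); rewrite xi.
  have xidx : x \in nth finset.set0 s (idx x).
    by apply: (nth_find finset.set0 (a := fun H => x \in H)); rewrite has_find idx_lt.
  rewrite leq_eqVlt => /predU1P[<-//|lt].
  have /proper_sub/fintype.subsetP :=
    sorted_ltn_nth tr finset.set0 ps (idx x) i (idx_lt x) im lt.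
  exact.
pose val i : R := (m - i)%:R / m%:R.
(* Only [i] needs the bound: for [j] at least [m], truncated subtraction gives [val j] the value 0,
   below [val i], and both sides are false. *)
have val_le i j : (i < m)%N -> (val i <= val j) = (j <= i)%N.
  move=> im; rewrite ler_pM2r ?invr_gt0 ?ltr0n // ler_nat.
  lia.
pose mu x := val (idx x).
have fmu : is_fuzzy_subgroup mu.
  split=> [x|x y|x].
  - rewrite divr_ge0 ?ler0n //= ler_pdivrMr ?ltr0n // mul1r ler_nat.
    exact: leq_subr.
  (* Both [x] and [y] lie in the term of index [maxn (idx x) (idx y)]; it is a subgroup, so it
     contains their product. *)
  - have sub z i : (idx z <= i < m)%N -> z \in nth finset.set0 s i.
      by case/andP=> zi im; rewrite mem_nths.
    rewrite ge_min !val_le // -leq_max.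
    have lt : (maxn (idx x) (idx y) < m)%N by rewrite gtn_max !idx_lt.
    have gH := gs _ (mem_nth finset.set0 lt).
    rewrite -mem_nths //; case/group_setP: gH => _; apply.
      by rewrite sub // lt leq_maxl.
    by rewrite sub // lt leq_maxr.
  rewrite val_le // -mem_nths //.
  have gH := gs _ (mem_nth finset.set0 (idx_lt x)).
  by rewrite (groupV (Group gH)) /= mem_nths.
exists mu => //; rewrite /level_chain.
have -> : level_values mu = map val (iota 0 m).
  apply: (irr_sorted_eq (leT := >%O)).
  - exact: rev_trans lt_trans.
  - by move=> x; apply: ltxx.
  - exact: level_values_sorted.
  - apply: (homo_sorted_in (P := [pred i | i < m]%N)) (iota_ltn_sorted 0 m).
      by move=> i j im jm ij; rewrite /= ltNge val_le -?ltnNge.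
    by apply/allP=> i; rewrite mem_iota.
  move=> v; rewrite mem_level_values; apply/codomP/mapP => [[x ->]|[i + ->]].
    by exists (idx x); rewrite ?mem_iota ?idx_lt.
  rewrite mem_iota /= => im.
  (* Every height is attained: at index 0 by the identity, at [i.+1] by an element that the strict
     inclusion adds to term [i]. *)
  suff [x <-] : exists x, idx x = i by exists x.
  case: i im => [|i] im.
    exists 1%g; apply/eqP; rewrite -leqn0 -mem_nths //.
    by have /group_setP[] := gs _ (mem_nth finset.set0 im).
  have [im' lt] : (i < m)%N /\ (i < i.+1)%N by rewrite (ltnW im).
  have /properP[_ [x xi nx]] := sorted_ltn_nth tr finset.set0 ps i i.+1 im' im lt.
  exists x; apply/eqP; rewrite eqn_leq -mem_nths // xi /=.
  by rewrite ltnNge -mem_nths.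
rewrite -map_comp -[RHS](mkseq_nth finset.set0).
apply/eq_in_map => i; rewrite mem_iota /= => im.
by apply/setP=> x; rewrite inE mem_nths // val_le.
Qed.

End FuzzyChains.

(** * Fuzzy subgroups of the dihedral group up to equivalence *)

Definition fuzzy_code (R : realType) (gT : finGroupType) (a : gT)
    (mu : gT -> R) : seq (bool * nat) :=
  [seq d8_code a H | H <- level_chain mu].

Section FuzzyDihedral.

Lemma fuzzy_approxP (R : realType) (gT : finGroupType) (a b : gT) :
  dihedral8_gens a b ->
  forall mu eta : gT -> R, is_fuzzy_subgroup mu -> is_fuzzy_subgroup eta ->
  fuzzy_approx mu eta <-> fuzzy_code a mu = fuzzy_code a eta.
Proof.
move=> D mu eta fmu feta; split=> [[f Af Ef]|Ecode].
  rewrite /fuzzy_code -Ef -map_comp; apply/eq_map => H /=.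
  exact: (d8_code_aut D).
have subs (nu : gT -> R) :
    sorted (fun H K : {set gT} => H \subset K) (level_chain nu).
  apply: sub_sorted (level_chain_proper nu) => H K; exact: proper_sub.
have [f Af nf] := d8_normalized_chain D (subs mu).
have [g Ag ng] := d8_normalized_chain D (subs eta).
suff Efg : [seq g @: (H : {set gT}) | H <- level_chain eta] =
           [seq f @: (H : {set gT}) | H <- level_chain mu].
  (* Products of permutations act from left to right: [g] normalizes the chain of [eta], then [f^-1]
     carries the common normal form to the chain of [mu]. *)
  exists (g * f^-1)%g; first by rewrite groupM ?groupV.
  transitivity [seq (f^-1)%g @: (H : {set gT})
               | H <- [seq g @: (H : {set gT}) | H <- level_chain eta]].
    rewrite -map_comp; apply: eq_map => H /=; rewrite -imset_comp.
    by apply: eq_imset => x /=; rewrite permM.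
  rewrite Efg -map_comp -[RHS]map_id; apply: eq_map => H /=.
  rewrite -imset_comp -[RHS]imset_id; apply: eq_imset => x /=.
  by rewrite permK.
have sz : size (level_chain eta) = size (level_chain mu).
  by have := congr1 size Ecode; rewrite !size_map.
apply: (@eq_from_nth _ finset.set0); rewrite !(size_map _ (level_chain _)) // => i lt_eta.
have lt_mu : (i < size (level_chain mu))%N by rewrite -sz.
rewrite (nth_map finset.set0) // (nth_map finset.set0 _ _ lt_mu).
have Heta := mem_nth finset.set0 lt_eta; have Hmu := mem_nth finset.set0 lt_mu.
have gg := group_set_aut Ag (level_chain_group feta Heta).
have gf := group_set_aut Af (level_chain_group fmu Hmu).
apply: (d8_code_inj D (H := Group gg) (K := Group gf)) => /=.
- exact: ng.
- exact: nf.
rewrite !(d8_code_aut D) //.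
have := congr1 (nth (true, 0)%N ^~ i) Ecode.
by rewrite (nth_map finset.set0 _ _ lt_mu) (nth_map finset.set0 _ _ lt_eta).
Qed.

Lemma fuzzy_code_mem (R : realType) (gT : finGroupType) (a b : gT) :
  dihedral8_gens a b ->
  forall mu : gT -> R, is_fuzzy_subgroup mu ->
  fuzzy_code a mu \in d8_code_chains.
Proof.
move=> D mu fmu; rewrite mem_d8_code_chains; apply/and3P; split.
- apply/allP=> _ /mapP[H /(level_chain_group fmu) gH ->].
  exact: (d8_code_mem D (Group gH)).
- have := level_chain_proper mu; have := level_chain_group fmu.
  rewrite /fuzzy_code; case: (level_chain mu) => //= H s gs ps.
  (* The step from the virtual start only asks that the first subgroup be nonempty. *)
  rewrite {1}/code_lt /= implybT (cardG_gt0 (Group (gs H (mem_head _ _)))) /=.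
  rewrite path_map; apply: sub_path ps => K L; exact: d8_code_lt.
have := level_chain_last mu; rewrite /fuzzy_code.
case: (level_chain mu) => [/setP/(_ 1%g)|H s] /=; first by rewrite !inE.
by rewrite last_map => ->; rewrite (d8_codeT D).
Qed.

Lemma fuzzy_code_surj (R : realType) (gT : finGroupType) (a b : gT) :
  dihedral8_gens a b ->
  forall s, s \in d8_code_chains ->
  exists2 mu : gT -> R, is_fuzzy_subgroup mu & fuzzy_code a mu = s.
Proof.
move=> D s; rewrite mem_d8_code_chains => /and3P[cs ps /eqP ls].
have codeK : {in s, forall p, d8_code a (d8_sub a b p) = p}.
  by move=> p sp; apply: (d8_subK D); apply: (allP cs).
have [|||mu fmu Emu] :=
    @chain_realization R gT [seq (d8_sub a b p : {set gT}) | p <- s].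
- by move=> _ /mapP[p _ ->]; apply: groupP.
- apply: (homo_sorted_in (P := mem d8_codes)) cs (path_sorted ps).
  by move=> p q cp cq; apply: (d8_sub_proper D).
- have lT : d8_sub a b (false, 8)%N = [set: gT]%SET :> {set gT}.
    apply/eqP; rewrite eqEcard finset.subsetT /=.
    have [oG _ _ _ _] := D; rewrite oG.
    by have [_ ->] := d8_subK D (isT : (false, 8)%N \in d8_codes).
  case/lastP: s ls {cs ps codeK} => //= s q.
  by rewrite last_rcons => ->; rewrite map_rcons last_rcons.
exists mu => //; rewrite /fuzzy_code Emu -map_comp -[RHS]map_id.
by apply/eq_in_map.
Qed.

End FuzzyDihedral.

(** * Counting the classes *)

Theorem theorem4p3p1 (R : realType) (gT : finGroupType)
  (D8 : ([set: gT] \isog Grp (a : b : a ^+ 4, b ^+ 2, b * a * b = a^-1))%g) :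
  exists N : nat,
    [/\ (fuzzy_classes R gT #= `I_N)%card,
        N%:R = 1 / 8 * (32 + 4 * 8 + 16 + 2 * 24) :> rat
      & N = 16%N].
Proof.
exists 16%N; split=> //.
have [a [b D]] := dihedral8_gensP D8.
(* [F i] realizes the [i]-th code sequence; from 16 on, the constant 0 is a dummy value. *)
have /choice[F FP] (i : nat) : exists mu : gT -> R, (i < 16)%N ->
    is_fuzzy_subgroup mu /\ fuzzy_code a mu = nth [::] d8_code_chains i.
  have [lt|_] := ltnP i 16; last by exists (fun=> 0).
  rewrite -size_d8_code_chains in lt.
  have [mu fmu Emu] := fuzzy_code_surj R D (mem_nth [::] lt).
  by exists mu.
have code_eqP (mu eta : gT -> R) : is_fuzzy_subgroup mu ->
    is_fuzzy_subgroup eta ->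
    fuzzy_class mu = fuzzy_class eta <-> fuzzy_code a mu = fuzzy_code a eta.
  move=> fmu feta; split=> [Ecl|Ecode].
    apply/(fuzzy_approxP D fmu feta).
    have : fuzzy_class eta eta by split=> //; apply/(fuzzy_approxP D).
    by rewrite -Ecl => -[].
  apply/seteqP; split=> nu [fnu /(fuzzy_approxP D) E]; split=> //;
    apply/(fuzzy_approxP D) => //.
    by rewrite -Ecode E.
  by rewrite Ecode E.
have -> : fuzzy_classes R gT = [set fuzzy_class (F i) | i in `I_16]%classic.
  apply/seteqP; split=> [_ [mu fmu <-]|_ [i /= lt <-]]; last first.
    by have [fF _] := FP i lt; exists (F i).
  have cmu := fuzzy_code_mem D fmu.
  have lt : (index (fuzzy_code a mu) d8_code_chains < 16)%N.
    by rewrite -size_d8_code_chains index_mem.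
  exists (index (fuzzy_code a mu) d8_code_chains) => //.
  have [fF EF] := FP _ lt.
  by apply/code_eqP => //; rewrite EF nth_index.
(* Distinct indices give distinct classes because the list of code sequences has no repetition. *)
apply: inj_card_eq => i j; rewrite !inE /= => ilt jlt.
have [[fi Ei] [fj Ej]] := (FP i ilt, FP j jlt).
move/(code_eqP _ _ fi fj); rewrite Ei Ej => /eqP.
by rewrite nth_uniq ?uniq_d8_code_chains ?size_d8_code_chains // => /eqP.
Qed.
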